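(* Suppose the polynomials $Q_n(x)$, $n\ge0$, are orthogonal with respect to a nondegenerate linear functional $\tau$, and let $\mathcal R$ be the linear operator with $\mathcal R Q_n=\nu_{n+1}P_{n+1}$ ($n\ge0$, $\nu_{n+1}\neq0$) satisfying $\langle \tau, g\,\mathcal D f\rangle = \langle \sigma, f\,\mathcal R g\rangle$ for all polynomials $f,g$. Put $L=\mathcal R\mathcal D$, $\tilde L=\mathcal D\mathcal R$, $\lambda_0=0$ and $\lambda_n=\mu_n\nu_n$ for $n\ge1$. Then for all $n\ge0$ $$L P_n(x)=\lambda_nP_n(x),\qquad \tilde L Q_n(x)=\lambda_{n+1}Q_n(x),$$ and for all polynomials $f,g$ $$\langle\sigma,f\,Lg\rangle=\langle\sigma,g\,Lf\rangle,\qquad \langle\tau,f\,\tilde Lg\rangle=\langle\tau,g\,\tilde Lf\rangle.$$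
   Context: All polynomials have complex coefficients. A linear functional on polynomials is nondegenerate if all Hankel determinants $\det|m_{i+k}|_{i,k=0}^{n-1}$, $n\ge1$, of its moments $m_n$ are nonzero. $\sigma$ is a nondegenerate linear functional with moments $g_n=\langle\sigma,x^n\rangle$, $g_0=1$, and $P_n(x)=x^n+O(x^{n-1})$ are its monic orthogonal polynomials: $\langle\sigma,P_nP_m\rangle=h_n\delta_{nm}$, $h_n\ne0$. A generalized derivative operator $\mathcal D$ is the linear operator on polynomials with $\mathcal D x^n=\mu_n x^{n-1}$, where $\mu_n$ are complex numbers with $\mu_0=0$ and $\mu_n\neq0$ for $n\ge1$. The derived monic polynomials are $Q_n(x)=\mu_{n+1}^{-1}\mathcal D P_{n+1}(x)$, $n\ge 0$. (When the $Q_n$ are orthogonal with respect to $\tau$, an operator $\mathcal R$ as in the claim exists and is unique.) *)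

(* Defs.v *)
From HB Require Import structures.
From mathcomp Require Import all_boot all_order all_algebra.
From mathcomp Require Import reals complex.

Set Implicit Arguments.
Unset Strict Implicit.
Unset Printing Implicit Defensive.

Import GRing.Theory.
Local Open Scope ring_scope.

Section Orthogonality.
Variable C : fieldType.
Implicit Types (sigma : {scalar {poly C}}) (P : nat -> {poly C}).

Definition moment sigma (n : nat) : C := sigma 'X^n.

Definition hankel sigma (n : nat) : 'M[C]_n :=
  \matrix_(i < n, k < n) moment sigma (i + k)%N.

Definition nondegenerate_functional sigma : Prop :=
  forall n : nat, (1 <= n)%N -> \det (hankel sigma n) != 0.

(* P n = x^n + O(x^(n-1)); size is degree + 1 *)
Definition monic_sequence P : Prop :=
  forall n : nat, P n \is monic /\ size (P n) = n.+1.

Definition orthogonal_wrt sigma P : Prop :=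
  exists2 h : nat -> C, forall n, h n != 0
    & forall n m, sigma (P n * P m) = h n *+ (n == m).

(* At n = 0 the truncated exponent 0.-1 = 0 is harmless, since mu 0 = 0. *)
Definition generalized_derivative (mu : nat -> C)
    (D : {linear {poly C} -> {poly C}}) : Prop :=
  [/\ mu 0%N = 0,
      forall n, (1 <= n)%N -> mu n != 0
    & forall n, D 'X^n = mu n *: 'X^(n.-1)].

Definition derived_polynomials (mu : nat -> C)
    (D : {linear {poly C} -> {poly C}}) P (n : nat) : {poly C} :=
  (mu n.+1)^-1 *: D (P n.+1).

(* nu 0 is never used *)
Definition eigenvalues (mu nu : nat -> C) (n : nat) : C :=
  if n is 0%N then 0 else mu n * nu n.

End Orthogonality.

(* Main.v *)
Require Import Defs.
From HB Require Import structures.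
From mathcomp Require Import all_boot all_order all_algebra.
From mathcomp Require Import reals complex.

Set Implicit Arguments.
Unset Strict Implicit.
Unset Printing Implicit Defensive.

Import GRing.Theory.
Local Open Scope ring_scope.

(** The adjunction between [D] and [Rop] turns both bilinear forms into
    Gram-type forms: [sigma (f * Rop (D g)) = tau (D g * D f)] and
    [tau (f * D (Rop g)) = sigma (Rop g * Rop f)], which are visibly symmetric
    in [f] and [g] ([raise_lower_sym], [lower_raise_sym]).  For the eigenvalue
    equations ([raise_lower_eigen], [lower_raise_eigen]), [D] sends [P n.+1] to
    [mu n.+1 *: Q n] and [Rop] sends [Q n] back to [nu n.+1 *: P n.+1], so either
    composite multiplies by [mu n.+1 * nu n.+1]; the eigenvalue 0 occurs because
    [P 0 = 1] is a constant, which [D] kills. *)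

Section DerivedSequence.
Variables (C : fieldType) (mu nu : nat -> C) (P : nat -> {poly C}).
Variables (D Rop : {linear {poly C} -> {poly C}}).
Hypothesis D_gen : generalized_derivative mu D.
Let Q := derived_polynomials mu D P.

Lemma generalized_derivative_monic0 :
  monic_sequence P -> D (P 0%N) = 0.
Proof.
case: D_gen => mu0 _ D_Xn /(_ 0%N) [P0_monic /eqP sP0].
have -> : P 0%N = 1.
  rewrite (size1_polyC (eq_leq (eqP sP0))).
  by move/eqP: P0_monic; rewrite lead_coefE (eqP sP0) => ->.
by rewrite -(expr0 'X) D_Xn mu0 scale0r.
Qed.

Lemma generalized_derivative_succ n : D (P n.+1) = mu n.+1 *: Q n.
Proof.
case: D_gen => _ mu_neq0 _.
by rewrite /Q /derived_polynomials scalerA divff ?scale1r ?mu_neq0.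
Qed.

Hypothesis Rop_Q : forall n, Rop (Q n) = nu n.+1 *: P n.+1.

Lemma raise_lower_eigen n :
  monic_sequence P -> Rop (D (P n)) = eigenvalues mu nu n *: P n.
Proof.
move=> P_monic; case: n => [|n].
  by rewrite generalized_derivative_monic0 // linear0 scale0r.
by rewrite generalized_derivative_succ linearZ /= Rop_Q scalerA.
Qed.

Lemma lower_raise_eigen n : D (Rop (Q n)) = eigenvalues mu nu n.+1 *: Q n.
Proof.
by rewrite Rop_Q linearZ /= generalized_derivative_succ scalerA mulrC.
Qed.

End DerivedSequence.

Section AdjointPair.
Variables (C : fieldType) (sigma tau : {scalar {poly C}}).
Variables (D Rop : {linear {poly C} -> {poly C}}).
Hypothesis Rop_adj : forall f g, tau (g * D f) = sigma (f * Rop g).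

Lemma raise_lower_sym f g : sigma (f * Rop (D g)) = sigma (g * Rop (D f)).
Proof. by rewrite -!Rop_adj mulrC. Qed.

Lemma lower_raise_sym f g : tau (f * D (Rop g)) = tau (g * D (Rop f)).
Proof. by rewrite !Rop_adj mulrC. Qed.

End AdjointPair.

Theorem mainTheorem3 (R : realType)
    (sigma tau : {scalar {poly R[i]}})
    (P : nat -> {poly R[i]})
    (mu nu : nat -> R[i])
    (D Rop : {linear {poly R[i]} -> {poly R[i]}})
    (sigma_nondeg : nondegenerate_functional sigma)
    (sigma_norm : moment sigma 0 = 1)
    (P_monic : monic_sequence P)
    (P_orth : orthogonal_wrt sigma P)
    (D_gen : generalized_derivative mu D) :
  let Q := derived_polynomials mu D P in
  forall (tau_nondeg : nondegenerate_functional tau)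
    (Q_orth : orthogonal_wrt tau Q)
    (nu_neq0 : forall n : nat, nu n.+1 != 0)
    (Rop_Q : forall n : nat, Rop (Q n) = nu n.+1 *: P n.+1)
    (Rop_adj : forall f g : {poly R[i]}, tau (g * D f) = sigma (f * Rop g)),
  let L := fun p : {poly R[i]} => Rop (D p) in
  let Lt := fun p : {poly R[i]} => D (Rop p) in
  let lambda := eigenvalues mu nu in
  [/\ forall n : nat, L (P n) = lambda n *: P n,
      forall n : nat, Lt (Q n) = lambda n.+1 *: Q n,
      forall f g : {poly R[i]}, sigma (f * L g) = sigma (g * L f)
    & forall f g : {poly R[i]}, tau (f * Lt g) = tau (g * Lt f)].
Proof.
move=> Q tau_nondeg Q_orth nu_neq0 Rop_Q Rop_adj L Lt lambda; split.
- move=> n; exact: raise_lower_eigen.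
- move=> n; exact: lower_raise_eigen.
- exact: raise_lower_sym.
- exact: lower_raise_sym.
Qed.
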